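(* Let $\mathcal{A}$ be a set of propositional atoms (attributes) containing pairwise distinct atoms $a,b,c,d,x,y$, and let $K=\{a\wedge b\rightarrow x,\; c\wedge d\rightarrow x,\; a\wedge c\rightarrow y,\; b\wedge d\rightarrow y,\; a\wedge d\rightarrow y,\; b\wedge c\rightarrow y\}$. Then $K$ cannot be simulated by the embedding strategy $(\phi_{\mathrm{norm}},\psi_{\mathrm{dot}})$. That is, there do not exist an integer $m\geq 1$, vectors $\mathbf{p},\tilde{\mathbf{p}}\in\mathbb{R}^m$ and thresholds $\lambda_p\in\mathbb{R}$ (for $p\in\mathcal{A}$) such that for every $q\in\mathcal{A}$ and every finite (possibly empty) set $\{p_1,\dots,p_n\}\subseteq\mathcal{A}$ of $n$ distinct attributes: $$q\in \mathrm{Lab}_{\mathrm{dot}}(\mathrm{Emb}_{\mathrm{norm}}(p_1,\dots,p_n)) \iff K\models p_1\wedge\dots\wedge p_n\rightarrow q .$$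
   Context: Each attribute $p\in\mathcal{A}$ is assigned two vectors $\mathbf{p},\tilde{\mathbf{p}}\in\mathbb{R}^m$ (possibly different) and a threshold $\lambda_p\in\mathbb{R}$; the dimension $m$ may be chosen arbitrarily. The embedding function is $\mathrm{Emb}_{\mathrm{norm}}(p_1,\dots,p_n)=\frac{\mathbf{p}_1+\dots+\mathbf{p}_n}{\|\mathbf{p}_1+\dots+\mathbf{p}_n\|}$ if $\|\mathbf{p}_1+\dots+\mathbf{p}_n\|>0$, and $\mathrm{Emb}_{\mathrm{norm}}(p_1,\dots,p_n)=\mathbf{0}$ otherwise; in particular $\mathrm{Emb}_{\mathrm{norm}}(\emptyset)=\mathbf{0}$. The labelling function is $\mathrm{Lab}_{\mathrm{dot}}(\mathbf{e})=\{q\in\mathcal{A} \mid \mathbf{e}\cdot\tilde{\mathbf{q}}\geq\lambda_q\}$ for $\mathbf{e}\in\mathbb{R}^m$. The symbol $\models$ denotes standard propositional entailment over the atoms $\mathcal{A}$; the empty conjunction is $\top$. *)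

(* Defs.v *)
(* MathComp, with MathComp-Analysis for [realType] and [set]. *)
From mathcomp Require Import all_boot all_order all_algebra.
From mathcomp Require Import boolp classical_sets reals.

Set Implicit Arguments.
Unset Strict Implicit.
Unset Printing Implicit Defensive.

Import Order.TTheory GRing.Theory Num.Theory.
Local Open Scope ring_scope.
Local Open Scope classical_set_scope.

(* Negation and disjunction are definable from [Bot] and [Imp]. *)
Inductive formula (A : Type) : Type :=
| Atom of A
| Top
| Bot
| And of formula A & formula A
| Imp of formula A & formula A.

Arguments Top {A}.
Arguments Bot {A}.

Fixpoint eval (A : Type) (v : A -> bool) (f : formula A) : bool :=
  match f with
  | Atom p => v p
  | Top => true
  | Bot => false
  | And g h => eval v g && eval v h
  | Imp g h => eval v g ==> eval v h
  end.

Definition entails (A : Type) (K : set (formula A)) (f : formula A) : Prop :=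
  forall v : A -> bool, (forall k, K k -> eval v k) -> eval v f.

Definition conj_atoms (A : Type) (s : seq A) : formula A :=
  \big[@And A/Top]_(p <- s) Atom p.

(* A finite set of n distinct attributes is a duplicate-free sequence. *)
Definition simulates (A : eqType) (E : Type) (K : set (formula A))
    (emb : seq A -> E) (lab : E -> set A) : Prop :=
  forall (q : A) (s : seq A), uniq s ->
    (lab (emb s) q <-> entails K (Imp (conj_atoms s) (Atom q))).

Definition dot (R : realType) (m : nat) (u v : 'rV[R]_m) : R :=
  \sum_(i < m) u 0 i * v 0 i.

(* The Euclidean norm; the norm of MathComp-Analysis on ['rV[R]_m] is the
   sup norm. *)
Definition enorm (R : realType) (m : nat) (u : 'rV[R]_m) : R :=
  Num.sqrt (dot u u).

Definition Emb_norm (R : realType) (A : Type) (m : nat)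
    (vec : A -> 'rV[R]_m) (s : seq A) : 'rV[R]_m :=
  let u := \sum_(p <- s) vec p in
  if 0 < enorm u then (enorm u)^-1 *: u else 0.

Definition Lab_dot (R : realType) (A : Type) (m : nat)
    (tvec : A -> 'rV[R]_m) (lam : A -> R) (e : 'rV[R]_m) : set A :=
  [set q | dot e (tvec q) >= lam q].

Definition rule2 (A : Type) (p q r : A) : formula A :=
  Imp (And (Atom p) (Atom q)) (Atom r).

(* Main.v *)
Require Import Defs.
From mathcomp Require Import all_boot all_order all_algebra.
From mathcomp Require Import boolp classical_sets reals.

Set Implicit Arguments.
Unset Strict Implicit.
Unset Printing Implicit Defensive.

Import Order.TTheory GRing.Theory Num.Theory.
Local Open Scope ring_scope.
Local Open Scope classical_set_scope.

(** The empty set yields no attribute, so every threshold is positive. Hence a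
    set labelled by [q] has a nonzero sum [u], and then [q] labels it iff
    [lam q * enorm u <= dot u (tvec q)]. Put [s = a + b + c + d]. Adding up the
    inequalities for [x] over the two pairings [ab|cd] and [ac|bd] of the summands
    of [s] gives
    [lam x * (|a+b| + |c+d|) <= dot s (tvec x) < lam x * (|a+c| + |b+d|)],
    and those for [y] give the same strict comparison of the two norm sums the
    other way round. *)

Lemma dotDl (R : realType) (m : nat) (u v w : 'rV[R]_m) :
  dot (u + v) w = dot u w + dot v w.
Proof. by rewrite /dot -big_split; apply: eq_bigr => i _; rewrite mxE mulrDl. Qed.

Lemma dotZl (R : realType) (m : nat) (k : R) (u w : 'rV[R]_m) :
  dot (k *: u) w = k * dot u w.
Proof. by rewrite /dot mulr_sumr; apply: eq_bigr => i _; rewrite mxE mulrA. Qed.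

Lemma dot0l (R : realType) (m : nat) (w : 'rV[R]_m) : dot 0 w = 0.
Proof. by rewrite -(scale0r 0) dotZl mul0r. Qed.

Lemma eval_conj_atoms (A : Type) (v : A -> bool) (s : seq A) :
  eval v (conj_atoms s) = all v s.
Proof.
rewrite /conj_atoms; elim: s => [|p s IHs]; first by rewrite big_nil.
by rewrite big_cons /= IHs.
Qed.

(** A positive norm can be cleared from the threshold test. Otherwise the embedding defaults to 0,
    and its dot product 0 stays below [lam q]. *)
Lemma Lab_dot_Emb_normE (R : realType) (A : Type) (m : nat)
    (vec tvec : A -> 'rV[R]_m) (lam : A -> R) (s : seq A) (q : A) :
  let u := \sum_(p <- s) vec p in
  0 < lam q ->
  Lab_dot tvec lam (Emb_norm vec s) q <->
  0 < enorm u /\ lam q * enorm u <= dot u (tvec q).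
Proof.
move=> u lam_gt0; rewrite /Lab_dot /Emb_norm /= -/u.
case: ifPn => [u_gt0|_].
  by rewrite dotZl mulrC ler_pdivlMr //; split => [|[]].
by rewrite dot0l leNgt lam_gt0; split => [|[]].
Qed.

(* Strictness needs a nonzero sum; it is witnessed here by a label [r] that the
   set does carry. *)
Lemma Lab_dot_Emb_normN (R : realType) (A : Type) (m : nat)
    (vec tvec : A -> 'rV[R]_m) (lam : A -> R) (s : seq A) (q r : A) :
  let u := \sum_(p <- s) vec p in
  0 < lam q -> 0 < lam r ->
  Lab_dot tvec lam (Emb_norm vec s) r ->
  ~ Lab_dot tvec lam (Emb_norm vec s) q ->
  dot u (tvec q) < lam q * enorm u.
Proof.
move=> u lamq lamr /(Lab_dot_Emb_normE _ _ _ lamr)[u_gt0 _] Nq.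
by rewrite ltNge; apply/negP => le_u; apply/Nq/Lab_dot_Emb_normE.
Qed.

(** On the empty sequence [Emb_norm] returns 0, so the test for [q] reads [lam q <= 0]. *)
Lemma simulates_lam_gt0 (R : realType) (A : eqType) (K : set (formula A))
    (m : nat) (vec tvec : A -> 'rV[R]_m) (lam : A -> R) (q : A) :
  simulates K (Emb_norm vec) (Lab_dot tvec lam) ->
  ~ entails K (Imp (conj_atoms [::]) (Atom q)) -> 0 < lam q.
Proof.
move=> sim; rewrite -sim // /Lab_dot /Emb_norm /= big_nil /enorm dot0l sqrtr0.
by rewrite ltxx dot0l => /negP; rewrite -ltNge.
Qed.

(** Exchanging [p2] with [p3] and [q] with [r] swaps the two pairings, so one statement serves both
    [x] and [y]. The label [r] certifies that the sums of the second pairing are nonzero. *)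
Lemma pairing_norm_lt (R : realType) (A : Type) (m : nat)
    (vec tvec : A -> 'rV[R]_m) (lam : A -> R) (p1 p2 p3 p4 q r : A) :
  let lab s := Lab_dot tvec lam (Emb_norm vec s) in
  let nrm s := enorm (\sum_(p <- s) vec p) in
  0 < lam q -> 0 < lam r ->
  lab [:: p1; p2] q -> lab [:: p3; p4] q ->
  lab [:: p1; p3] r -> lab [:: p2; p4] r ->
  ~ lab [:: p1; p3] q -> ~ lab [:: p2; p4] q ->
  nrm [:: p1; p2] + nrm [:: p3; p4] < nrm [:: p1; p3] + nrm [:: p2; p4].
Proof.
move=> lab nrm lamq lamr.
move=> /(Lab_dot_Emb_normE _ _ _ lamq)[_ h12].
move=> /(Lab_dot_Emb_normE _ _ _ lamq)[_ h34] r13 r24.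
move=> /(Lab_dot_Emb_normN lamq lamr r13) h13.
move=> /(Lab_dot_Emb_normN lamq lamr r24) h24.
rewrite -(ltr_pM2l lamq) !mulrDr.
apply: le_lt_trans (lerD h12 h34) _; apply: le_lt_trans (ltrD h13 h24).
(* What remains is an equality: both pairings have the same total. *)
by rewrite -!dotDl !big_cons !big_nil !addr0 addrACA.
Qed.

Theorem mainTheorem3 (R : realType) (A : eqType) (a b c d x y : A)
    (hdistinct : uniq [:: a; b; c; d; x; y]) :
  let K : set (formula A) :=
    [set rule2 a b x; rule2 c d x; rule2 a c y;
         rule2 b d y; rule2 a d y; rule2 b c y] in
  ~ exists (m : nat) (vec tvec : A -> 'rV[R]_m) (lam : A -> R),
      (1 <= m)%N /\ simulates K (Emb_norm vec) (Lab_dot tvec lam).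
Proof.
move=> K [m [vec [tvec [lam [_ sim]]]]].
pose lab s := Lab_dot tvec lam (Emb_norm vec s).
have yes p1 p2 q : p1 != p2 -> K (rule2 p1 p2 q) -> lab [:: p1; p2] q.
  move=> ne Kr; apply/sim; first by rewrite /= inE ne.
  by move=> v /(_ _ Kr) /=; rewrite eval_conj_atoms /= andbT.
(* Here [v] is a countermodel: it satisfies the six rules and all of [s], but not [q]. *)
have no (v : pred A) s q : all v s -> ~~ v q ->
    [&& v a && v b ==> v x, v c && v d ==> v x, v a && v c ==> v y,
        v b && v d ==> v y, v a && v d ==> v y & v b && v c ==> v y] ->
    ~ entails K (Imp (conj_atoms s) (Atom q)).
  move=> vs vq /and5P[ab cd ac bd /andP[ad bc]] /(_ v).
  rewrite /= eval_conj_atoms vs (negbTE vq) => H.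
  by have: false by apply: H => _ [[[[[->|->]|->]|->]|->]|->].
have lam_gt0 q : 0 < lam q.
  (* The all-false valuation satisfies [K], since every rule has a false premise. *)
  by apply: (simulates_lam_gt0 sim); apply: (no pred0).
move: hdistinct; rewrite /= !inE !negb_or !andbT.
move=> /and5P[/and5P[ab ac ad ax ay] /and4P[bc bd bx yb] /and3P[cd cx cy]
  /andP[dx dy] xy].
have neqs := (negbTE ab, negbTE ac, negbTE ad, negbTE ax, negbTE ay, negbTE bc,
  negbTE bd, negbTE bx, negbTE yb, negbTE cd, negbTE cx, negbTE cy, negbTE dx,
  negbTE dy, negbTE xy).
(* The countermodel makes just [p1], [p2] and [r] true; [r] will be the head of the rule that [p1]
   and [p2] fire. *)
have no2 p1 p2 q r : uniq [:: p1; p2] ->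
    let v := mem [:: p1; p2; r] in ~~ v q ->
    [&& v a && v b ==> v x, v c && v d ==> v x, v a && v c ==> v y,
        v b && v d ==> v y, v a && v d ==> v y & v b && v c ==> v y] ->
    ~ lab [:: p1; p2] q.
  move=> u v vq vK /(sim _ _ u); apply: (no v) => //.
  by rewrite /v /= !inE !eqxx /= orbT.
(* These turn each comparison to the orientation found in [neqs]. *)
have neqs' := (eq_sym b a, eq_sym c a, eq_sym d a, eq_sym x a, eq_sym y a,
  eq_sym c b, eq_sym d b, eq_sym x b, eq_sym y b, eq_sym d c, eq_sym x c,
  eq_sym y c, eq_sym x d, eq_sym y d, eq_sym y x).
have abx : lab [:: a; b] x by apply: yes => //; rewrite /K /=; tauto.
have cdx : lab [:: c; d] x by apply: yes => //; rewrite /K /=; tauto.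
have acy : lab [:: a; c] y by apply: yes => //; rewrite /K /=; tauto.
have bdy : lab [:: b; d] y by apply: yes => //; rewrite /K /=; tauto.
have Naby : ~ lab [:: a; b] y.
  by apply: (@no2 _ _ _ x); rewrite /= !inE ?neqs' !neqs ?eqxx.
have Ncdy : ~ lab [:: c; d] y.
  by apply: (@no2 _ _ _ x); rewrite /= !inE ?neqs' !neqs ?eqxx.
have Nacx : ~ lab [:: a; c] x.
  by apply: (@no2 _ _ _ y); rewrite /= !inE ?neqs' !neqs ?eqxx.
have Nbdx : ~ lab [:: b; d] x.
  by apply: (@no2 _ _ _ y); rewrite /= !inE ?neqs' !neqs ?eqxx.
have lt_x := pairing_norm_lt (lam_gt0 x) (lam_gt0 y) abx cdx acy bdy Nacx Nbdx.
have lt_y := pairing_norm_lt (lam_gt0 y) (lam_gt0 x) acy bdy abx cdx Naby Ncdy.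
by have := lt_trans lt_x lt_y; rewrite ltxx.
Qed.
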